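(* Let $(G,B,w)$ be a finite weighted graph with boundary $B$ and interior $\Omega=V(G)\setminus B$. Then for any $\alpha\in A^{k+1}(G)$ and $\beta\in A^k(G)$ ($k\ge 0$), $$\langle\delta\alpha,\beta\rangle_\Omega=\langle\alpha,d\beta\rangle_{G}-\langle\mathbf{N}\alpha,\beta\rangle_{\partial\Omega},$$ and for any $\alpha\in A^{k-1}(G)$ and $\beta\in A^k(G)$ ($k\ge 1$), $$\langle d\alpha,\beta\rangle_{\Omega}=\langle\alpha,\delta\beta\rangle_\Omega-\langle\mathbf{D}\alpha,\beta\rangle_{\partial\Omega}.$$ Here $\mathbf{N}\alpha,\mathbf{D}\alpha\in A^k(\partial\Omega)$ are given, when $\{v,v_1,\dots,v_k\}\in C_{k+1}(\partial\Omega)$ with $v\in B$ and $v_1,\dots,v_k\in\Omega$, by $$\mathbf{N}\alpha(v,v_1,\dots,v_k)=\frac{\sum_{u\in \Omega}\alpha(u,v,v_1,\dots,v_k)\,w(u,v,v_1,\dots,v_{k})}{w(v,v_1,\dots,v_k)}\quad(\alpha\in A^{k+1}(G))$$ and $$\mathbf{D}\alpha(v,v_1,\dots,v_k)=\alpha(v_1,\dots,v_k)\quad(\alpha\in A^{k-1}(G)).$$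
   Context: All graphs are simple. $V(G),E(G)$ are the vertex and edge sets. A $k$-clique of $G$ is a set of $k$ distinct pairwise adjacent vertices; $C_k(G)$ is the set of $k$-cliques. A $k$-form on $G$ ($k\ge 0$) is a function $f:V(G)^{k+1}\to\mathbb{R}$ that is skew-symmetric in its variables and satisfies $f(v_0,\dots,v_k)=0$ whenever $\{v_0,\dots,v_k\}\notin C_{k+1}(G)$; $A^k(G)$ is the space of $k$-forms. The exterior differential $d:A^k(G)\to A^{k+1}(G)$ is $d\alpha(v_0,\dots,v_{k+1})=\sum_{j=0}^{k+1}(-1)^j\alpha(v_0,\dots,\hat v_j,\dots,v_{k+1})$ if $\{v_0,\dots,v_{k+1}\}\in C_{k+2}(G)$, and $0$ otherwise. A weight $w$ on $G$ assigns, for every $k\ge0$, to each $(v_0,\dots,v_k)\in V(G)^{k+1}$ a real number $w(v_0,\dots,v_k)$, symmetric in the variables, positive if $\{v_0,\dots,v_k\}\in C_{k+1}(G)$ and $0$ otherwise. For finite $G$, $\langle\alpha,\beta\rangle_G=\frac1{(k+1)!}\sum_{v_0,\dots,v_k\in V(G)}\alpha(v_0,\dots,v_k)\beta(v_0,\dots,v_k)w(v_0,\dots,v_k)$ is the inner product on $A^k(G)$, and $\delta:A^{k+1}(G)\to A^k(G)$ is the adjoint of $d$. A graph with boundary $(G,B)$ is a simple graph $G$ with $B\subset V(G)$ such that no two vertices of $B$ are adjacent and every vertex of $B$ is adjacent to some vertex of $\Omega:=V(G)\setminus B$ (the interior). $C_{k+1}(\partial\Omega)$ is the set of $(k+1)$-cliques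 of $G$ with exactly one vertex in $B$ and the remaining $k$ vertices in $\Omega$. $A^k(\partial\Omega)$ is the space of functions $f:B\times\Omega^k\to\mathbb{R}$, skew-symmetric in the last $k$ variables, with $f(v_0,\dots,v_k)=0$ when $\{v_0,\dots,v_k\}\notin C_{k+1}(\partial\Omega)$. Its inner product is $\langle\alpha,\beta\rangle_{\partial\Omega}=\frac1{k!}\sum_{v\in B}\sum_{v_1,\dots,v_k\in\Omega}\alpha(v,v_1,\dots,v_k)\beta(v,v_1,\dots,v_k)w(v,v_1,\dots,v_k)$; forms in $A^k(G)$ appearing in it are restricted to $B\times\Omega^k$. For $\alpha,\beta\in A^k(G)$, $\langle\alpha,\beta\rangle_\Omega=\sum\alpha(v_0,\dots,v_k)\beta(v_0,\dots,v_k)w(v_0,\dots,v_k)$, the sum running over the $(k+1)$-cliques $\{v_0,\dots,v_k\}$ contained in $\Omega$. *)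

(* Defs.v *)
From HB Require Import structures.
From mathcomp Require Import all_boot all_order all_algebra all_fingroup.
From mathcomp Require Import boolp classical_sets reals.

Set Implicit Arguments.
Unset Strict Implicit.
Unset Printing Implicit Defensive.
Import Order.TTheory GRing.Theory Num.Theory.
Local Open Scope ring_scope.

Record sgraph (V : finType) := SGraph {
  adj : rel V;
  adj_sym : symmetric adj;
  adj_irr : irreflexive adj }.

Definition cliques (V : finType) (G : sgraph V) (n : nat) : {set {set V}} :=
  [set S : {set V} | (#|S| == n) &&
     [forall x in S, forall y in S, (x != y) ==> adj G x y]].

Definition perm_tuple (T : Type) (n : nat) (s : 'S_n) (t : n.-tuple T) :
  n.-tuple T := [tuple tnth t (s i) | i < n].

Definition del_tuple (T : Type) (n : nat) (j : 'I_n.+1) (t : n.+1.-tuple T) :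
  n.-tuple T := [tuple tnth t (lift j i) | i < n].

Definition skew_symmetric (R : realType) (T : Type) (n : nat) (f : n.-tuple T -> R) :
  Prop := forall (s : 'S_n) (t : n.-tuple T),
    f (perm_tuple s t) = (-1) ^+ odd_perm s * f t.

(* A^k(G); a (k+1)-tuple with a repeated entry spans a set of fewer than k+1
   vertices, so the support condition makes f vanish on it. *)
Definition forms (R : realType) (V : finType) (G : sgraph V) (k : nat)
    (f : k.+1.-tuple V -> R) : Prop :=
  skew_symmetric f /\
  forall t : k.+1.-tuple V, [set x in t] \notin cliques G k.+1 -> f t = 0.

Definition extd (R : realType) (V : finType) (G : sgraph V) (k : nat)
    (a : k.+1.-tuple V -> R) : k.+2.-tuple V -> R :=
  fun t => if [set x in t] \in cliques G k.+2
           then \sum_(j < k.+2) (-1) ^+ j * a (del_tuple j t)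
           else 0.

Record weight (R : realType) (V : finType) (G : sgraph V) := Weight {
  wt : forall k : nat, k.+1.-tuple V -> R;
  wt_sym : forall (k : nat) (s : 'S_k.+1) (t : k.+1.-tuple V),
    wt (perm_tuple s t) = wt t;
  wt_gt0 : forall (k : nat) (t : k.+1.-tuple V),
    [set x in t] \in cliques G k.+1 -> 0 < wt t;
  wt_eq0 : forall (k : nat) (t : k.+1.-tuple V),
    [set x in t] \notin cliques G k.+1 -> wt t = 0 }.

Definition dotG (R : realType) (V : finType) (G : sgraph V) (w : weight R G)
    (k : nat) (a b : k.+1.-tuple V -> R) : R :=
  (k.+1)`!%:R^-1 * \sum_(t : k.+1.-tuple V) a t * b t * wt w t.

Definition is_adjoint_value (R : realType) (V : finType) (G : sgraph V)
    (w : weight R G) (k : nat) (a : k.+2.-tuple V -> R)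
    (c : k.+1.-tuple V -> R) : Prop :=
  forms G c /\
  forall b : k.+1.-tuple V -> R, forms G b -> dotG w c b = dotG w a (extd G b).

(* The adjoint of extd. Since A^k(G) is a finite-dimensional inner product
   space, for a in A^{k+1}(G) exactly one c satisfies is_adjoint_value w a c;
   the default value 0 of xget is then not used. *)
Definition codiff (R : realType) (V : finType) (G : sgraph V)
    (w : weight R G) (k : nat) (a : k.+2.-tuple V -> R) :
  k.+1.-tuple V -> R := xget (fun=> 0) (is_adjoint_value w a).

Definition is_boundary (V : finType) (G : sgraph V) (B : {set V}) : Prop :=
  (forall x y : V, x \in B -> y \in B -> ~~ adj G x y) /\
  (forall x : V, x \in B -> exists2 y : V, y \in ~: B & adj G x y).

Definition bdcliques (V : finType) (G : sgraph V) (B : {set V}) (n : nat) :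
  {set {set V}} := [set S in cliques G n | #|S :&: B| == 1%N].

(* The vertex set B or ~: B as a type, so that functions on B x Omega^k are
   functions vset B -> k.-tuple (vset (~: B)) -> R. *)
Definition vset (V : finType) (A : {set V}) : finType := {x : V | x \in A}.

Definition bdtuple (V : finType) (B : {set V}) (k : nat) (v : vset B)
    (s : k.-tuple (vset (~: B))) : k.+1.-tuple V :=
  [tuple of val v :: map val s].

Definition bdforms (R : realType) (V : finType) (G : sgraph V) (B : {set V})
    (k : nat) (f : vset B -> k.-tuple (vset (~: B)) -> R) : Prop :=
  (forall v : vset B, skew_symmetric (f v)) /\
  forall (v : vset B) (s : k.-tuple (vset (~: B))),
    [set x in bdtuple v s] \notin bdcliques G B k.+1 -> f v s = 0.

Definition bdrestr (R : realType) (V : finType) (B : {set V}) (k : nat)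
    (a : k.+1.-tuple V -> R) : vset B -> k.-tuple (vset (~: B)) -> R :=
  fun v s => a (bdtuple v s).

Definition dotB (R : realType) (V : finType) (G : sgraph V) (w : weight R G)
    (B : {set V}) (k : nat) (a b : vset B -> k.-tuple (vset (~: B)) -> R) : R :=
  k`!%:R^-1 * \sum_(v : vset B) \sum_(s : k.-tuple (vset (~: B)))
    a v s * b v s * wt w (bdtuple v s).

Lemma card_clique (V : finType) (G : sgraph V) (n : nat)
    (S : vset (cliques G n)) : #|val S| = n.
Proof. by case: S => S /=; rewrite inE => /andP[/eqP]. Qed.

Definition clique_tuple (V : finType) (G : sgraph V) (n : nat)
    (S : vset (cliques G n)) : n.-tuple V :=
  tcast (card_clique S) (enum_tuple (mem (val S))).

(* A sum over cliques as sets: for forms a and b the summand does not depend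
   on the order in which clique_tuple lists the vertices. *)
Definition dotO (R : realType) (V : finType) (G : sgraph V) (w : weight R G)
    (B : {set V}) (k : nat) (a b : k.+1.-tuple V -> R) : R :=
  \sum_(S : vset (cliques G k.+1) | val S \subset ~: B)
    a (clique_tuple S) * b (clique_tuple S) * wt w (clique_tuple S).

Definition bdN (R : realType) (V : finType) (G : sgraph V) (w : weight R G)
    (B : {set V}) (k : nat) (a : k.+2.-tuple V -> R) :
  vset B -> k.-tuple (vset (~: B)) -> R :=
  fun v s => if [set x in bdtuple v s] \in bdcliques G B k.+1
    then (\sum_(u in ~: B) a [tuple of u :: bdtuple v s]
            * wt w [tuple of u :: bdtuple v s]) / wt w (bdtuple v s)
    else 0.

Definition bdD (R : realType) (V : finType) (G : sgraph V) (B : {set V})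
    (k : nat) (a : k.+1.-tuple V -> R) :
  vset B -> k.+1.-tuple (vset (~: B)) -> R :=
  fun v s => if [set x in bdtuple v s] \in bdcliques G B k.+2
    then a [tuple of map val s]
    else 0.

(* Main.v *)
(* Summing over ordered tuples instead of cliques, skew-symmetry gives
   <a, d b>_G = 1/(k+1)! sum_t sum_u a(u, t) b(t) w(u, t).  The sum over all
   cliques t splits into those inside Omega and those with exactly one vertex
   in B, since no two vertices of B are adjacent; by symmetry the B-vertex may
   be put first, and this part is the boundary term with N.  As b restricted to
   Omega is again a form, <delta a, b>_Omega = <a, d(b restricted)>_G is the
   part of the sum with t inside Omega.  Dually, <d a, b>_Omega restricts both
   u and t to Omega, <a, delta b>_Omega only t, and the terms with u in B
   are the boundary term with D. *)
Require Import Defs.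
From HB Require Import structures.
From mathcomp Require Import all_boot all_order all_algebra all_fingroup.
From mathcomp Require Import boolp classical_sets reals.

Set Implicit Arguments.
Unset Strict Implicit.
Unset Printing Implicit Defensive.
Import Order.TTheory GRing.Theory Num.Theory.
Local Open Scope ring_scope.

(** * Permuting, deleting and prepending tuple entries *)

Section Tuples.
Variable T : Type.

Lemma tnth_perm_tuple n (s : 'S_n) (t : n.-tuple T) i :
  tnth (perm_tuple s t) i = tnth t (s i).
Proof. exact: tnth_mktuple. Qed.

Lemma perm_tupleM n (s1 s2 : 'S_n) (t : n.-tuple T) :
  perm_tuple (s1 * s2)%g t = perm_tuple s1 (perm_tuple s2 t).
Proof. by apply: eq_from_tnth => i; rewrite !tnth_perm_tuple permM. Qed.

Lemma perm_tuple1 n (t : n.-tuple T) : perm_tuple 1%g t = t.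
Proof. by apply: eq_from_tnth => i; rewrite tnth_perm_tuple perm1. Qed.

Lemma perm_tuple_inj n (s : 'S_n) : injective (@perm_tuple T n s).
Proof.
by move=> t u /(congr1 (perm_tuple s^-1%g)); rewrite -!perm_tupleM mulVg !perm_tuple1.
Qed.

Lemma perm_tuple_cons n (s : 'S_n) u (t : n.-tuple T) :
  [tuple of u :: perm_tuple s t] =
  perm_tuple (lift_perm ord0 ord0 s) [tuple of u :: t].
Proof.
apply: eq_from_tnth => i; rewrite tnth_perm_tuple.
case: (unliftP ord0 i) => [j|] ->; last by rewrite lift_perm_id !tnth0.
by rewrite lift_perm_lift !tnthS tnth_perm_tuple.
Qed.

Lemma del_tuple_lift_perm n (j j' : 'I_n.+1) (s : 'S_n) (t : n.+1.-tuple T) :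
  del_tuple j (perm_tuple (lift_perm j j' s) t) = perm_tuple s (del_tuple j' t).
Proof.
apply: eq_from_tnth => i.
by rewrite tnth_perm_tuple !tnth_mktuple lift_perm_lift.
Qed.

Lemma del_tuple0_cons n u (t : n.-tuple T) :
  del_tuple ord0 [tuple of u :: t] = t.
Proof. by apply: eq_from_tnth => i; rewrite tnth_mktuple tnthS. Qed.

End Tuples.

(** Removing [j] from the domain and [s j] from the codomain leaves a permutation of the other
    indices, whose sign [odd_lift_perm] relates to that of [s]. *)
Lemma lift_perm_restr n (s : 'S_n.+1) j :
  exists s', s = lift_perm j (s j) s'.
Proof.
(* The default [i] of [odflt] is never reached, since [s (lift j i)] differs from [s j]. *)
pose f (i : 'I_n) := odflt i (unlift (s j) (s (lift j i))).
have fE i : lift (s j) (f i) = s (lift j i).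
  rewrite /f; case: unliftP => [k -> //|/perm_inj/esym/eqP].
  by rewrite (negbTE (neq_lift _ _)).
have f_inj : injective f.
  by move=> i1 i2 /(congr1 (lift (s j))); rewrite !fE => /perm_inj/lift_inj.
exists (perm f_inj); apply/permP => i.
case: (unliftP j i) => [k|] ->; last by rewrite lift_perm_id.
by rewrite lift_perm_lift permE fE.
Qed.

Lemma set_perm_tuple (V : finType) n (s : 'S_n) (t : n.-tuple V) :
  [set x in perm_tuple s t] = [set x in t].
Proof.
apply/setP => x; rewrite !inE; apply/tnthP/tnthP => -[i ->].
  by exists (s i); rewrite tnth_perm_tuple.
by exists (s^-1%g i); rewrite tnth_perm_tuple permKV.
Qed.

Lemma set_tuple_cons (V : finType) n (u : V) (t : n.-tuple V) :
  [set x in [tuple of u :: t]] = u |: [set x in t].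
Proof. by apply/setP => x; rewrite !inE. Qed.

(** * Sums over tuples and over cliques *)

Section TupleSums.
Variables (R : nmodType) (V : finType).

Lemma big_tuple_cons n (F : n.+1.-tuple V -> R) :
  \sum_t F t = \sum_u \sum_(t : n.-tuple V) F [tuple of u :: t].
Proof.
rewrite pair_big /=.
rewrite (reindex (fun p : V * n.-tuple V => [tuple of p.1 :: p.2])) //=.
exists (fun t => (thead t, [tuple of behead t])) => [[u t] _|t _] /=.
  by congr (_, _); apply: val_inj.
by rewrite -tuple_eta.
Qed.

Lemma big_perm_tuple n (s : 'S_n) (F : n.-tuple V -> R) :
  \sum_t F t = \sum_t F (perm_tuple s t).
Proof. exact/reindex_inj/perm_tuple_inj. Qed.

Lemma big_tuple_sub n (A : {set V}) (F : n.-tuple V -> R) :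
  \sum_(t : n.-tuple (vset A)) F (map_tuple val t) =
  \sum_(t : n.-tuple V | [set x in t] \subset A) F t.
Proof.
pose h (t : n.-tuple (vset A)) : n.-tuple V := map_tuple val t.
have h_inj : injective h.
  by move=> t u /(congr1 val)/inj_map tu; apply/val_inj/tu/val_inj.
transitivity (\sum_(t in [set: n.-tuple (vset A)]) F (h t)).
  by apply: eq_bigl => t; rewrite inE.
rewrite -(big_imset F); last by move=> t u _ _; apply: h_inj.
apply: eq_bigl => t; apply/imsetP/fintype.subsetP => [[u _ ->] x|tA].
  by rewrite inE => /mapP[y _ ->]; apply: valP.
have tAi i : tnth t i \in A by apply: tA; rewrite inE mem_tnth.
exists [tuple Sub (tnth t i) (tAi i) : vset A | i < n] => //.
by apply: eq_from_tnth => i; rewrite tnth_map tnth_mktuple SubK.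
Qed.

(* The [n!] orderings of an [n]-clique are its images under ['S_n]. *)
Lemma big_tuple_cliques (G : sgraph V) n (P : pred {set V}) (f : n.-tuple V -> R) :
  (forall s t, f (perm_tuple s t) = f t) ->
  (forall t, [set x in t] \notin cliques G n -> f t = 0) ->
  \sum_(t : n.-tuple V | P [set x in t]) f t =
  (\sum_(S : vset (cliques G n) | P (val S)) f (clique_tuple S)) *+ n`!.
Proof.
move=> f_sym f0.
have E : \sum_(t : n.-tuple V | P [set x in t]) f t =
   \sum_(t : n.-tuple V | P [set x in t] && ([set x in t] \in cliques G n)) f t.
  rewrite big_mkcondr; apply: eq_bigr => t _; case: ifPn => // /f0 //.
rewrite {}E (partition_big (fun t : n.-tuple V => [set x in t])
  (fun S => (S \in cliques G n) && P S)) => [|t]; last by rewrite andbC.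
rewrite (@big_sub_cond _ _ _ _ (mem (cliques G n)) P).
rewrite -sumrMnl; apply: eq_bigr => S PS.
have cS : [set x in clique_tuple S] = val S.
  by apply/setP => x; rewrite inE /clique_tuple memtE val_tcast mem_enum.
have uS : uniq (clique_tuple S) by rewrite val_tcast enum_uniq.
transitivity (\sum_(t in [set perm_tuple s (clique_tuple S) | s in [set: 'S_n]]) f t).
  apply: eq_bigl => t; apply/idP/imsetP => [/andP[_ /eqP tS]|[s _ ->]]; last first.
    by rewrite set_perm_tuple cS eqxx andbT PS; apply: valP.
  have : perm_eq t (clique_tuple S).
    have cSt : clique_tuple S =i t.
      by move=> x; have /setP/(_ x) := etrans cS (esym tS); rewrite !inE.
    rewrite perm_sym; apply: uniq_perm => //.
    by rewrite -(eq_uniq _ cSt) // !size_tuple.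
  by case/tuple_permP => s ts; exists s => //; apply: val_inj.
(* A clique tuple repeats no vertex, so distinct permutations give distinct orderings and the fibre
   over [S] has exactly [n!] elements. *)
rewrite big_imset /=; last first.
  move=> s1 s2 _ _ E; apply/permP => i; have := congr1 (fun t => tnth t i) E.
  by rewrite !tnth_perm_tuple => /tuple_uniqP; apply.
rewrite (eq_bigr (fun=> f (clique_tuple S))) => [|s _]; last exact: f_sym.
by rewrite sumr_const cardsT card_Sn.
Qed.

End TupleSums.

(** * Forms, the differential and its adjoint *)

Section Forms.
Variables (R : realType) (V : finType) (G : sgraph V) (w : weight R G).

Lemma skew_mul_sym n (a b : n.-tuple V -> R) s t :
  skew_symmetric a -> skew_symmetric b ->
  a (perm_tuple s t) * b (perm_tuple s t) = a t * b t.
Proof. by move=> -> ->; rewrite mulrACA -expr2 sqrr_sign mul1r. Qed.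

Lemma skew_cons n (a : n.+1.-tuple V -> R) s u (t : n.-tuple V) :
  skew_symmetric a ->
  a [tuple of u :: perm_tuple s t] = (-1) ^+ odd_perm s * a [tuple of u :: t].
Proof. by move=> sa; rewrite perm_tuple_cons sa odd_lift_perm. Qed.

Lemma wt_cons k s u (t : k.-tuple V) :
  wt w [tuple of u :: perm_tuple s t] = wt w [tuple of u :: t].
Proof. by rewrite perm_tuple_cons wt_sym. Qed.

(** Deleting position [s^-1 j] from the permuted tuple gives a permutation, by some [s'], of the
    tuple with [j] deleted. The parities of [s] and [s'] differ by that of [j + s^-1 j], which is
    the change in the alternating sign. *)
Lemma extd_skew k (a : k.+1.-tuple V -> R) :
  skew_symmetric a -> skew_symmetric (extd G a).
Proof.
move=> sa s t; rewrite /extd set_perm_tuple; case: ifP => _; last by rewrite mulr0.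
rewrite (reindex_inj (@perm_inj _ s^-1)) mulr_sumr; apply: eq_bigr => j _.
have [s' sE] := lift_perm_restr s (s^-1%g j); rewrite permKV in sE.
have -> : del_tuple (s^-1%g j) (perm_tuple s t) = perm_tuple s' (del_tuple j t).
  by rewrite {2}sE del_tuple_lift_perm.
have -> : odd_perm s = odd (s^-1%g j) (+) odd j (+) odd_perm s'.
  by rewrite {1}sE odd_lift_perm.
rewrite sa; case: (odd_perm s'); rewrite !signr_addb !signr_odd -!mulrA;
  by rewrite [in RHS](mulrCA (_ ^+ nat_of_bool _)) signrMK.
Qed.

Lemma forms_extd k (a : k.+1.-tuple V -> R) : forms G a -> forms G (extd G a).
Proof.
case=> sa _; split; first exact: extd_skew.
by move=> t; rewrite /extd => /negbTE ->.
Qed.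

(** With [A] the interior, this turns the product over interior cliques into one over all of [G],
    where adjointness is available. *)
Definition restrict_form k (A : {set V}) (b : k.+1.-tuple V -> R) :=
  fun t : k.+1.-tuple V => if [set x in t] \subset A then b t else 0.

Lemma forms_restrict k A (b : k.+1.-tuple V -> R) :
  forms G b -> forms G (restrict_form A b).
Proof.
case=> sb b0; split => [s t|t tC].
  by rewrite /restrict_form set_perm_tuple; case: ifP => _; rewrite ?mulr0 ?sb.
by rewrite /restrict_form b0 // if_same.
Qed.

Lemma dotGC k (a b : k.+1.-tuple V -> R) : dotG w a b = dotG w b a.
Proof. by congr (_ * _); apply: eq_bigr => t _; rewrite (mulrC (a t)). Qed.

Lemma dotOC B k (a b : k.+1.-tuple V -> R) : dotO w B a b = dotO w B b a.
Proof. by apply: eq_bigr => S _; rewrite (mulrC (a _)). Qed.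

(** Each interior clique has [(k+1)!] orderings with the same summand, which cancels the normalising
    factor of [dotG]. *)
Lemma dotO_restrict B k (a b : k.+1.-tuple V -> R) :
  forms G a -> forms G b -> dotO w B a b = dotG w a (restrict_form (~: B) b).
Proof.
move=> [sa _] [sb b0]; rewrite /dotG /dotO.
have -> : \sum_t a t * restrict_form (~: B) b t * wt w t =
  \sum_(t : k.+1.-tuple V | [set x in t] \subset ~: B) a t * b t * wt w t.
  rewrite [RHS]big_mkcond; apply: eq_bigr => t _; rewrite /restrict_form.
  by case: ifP => // _; rewrite mulr0 mul0r.
rewrite (@big_tuple_cliques _ _ G k.+1 (fun S => S \subset ~: B)
  (fun t => a t * b t * wt w t)) => [|s t|t /b0 ->].
- by rewrite -[X in _ = _ * X]mulr_natl mulKf // pnatr_eq0 -lt0n fact_gt0.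
- by rewrite wt_sym skew_mul_sym.
- by rewrite mulr0 mul0r.
Qed.

(* The [k.+2] terms of [extd] contribute equally: moving the deleted vertex to
   the front costs the sign that it carries. *)
Lemma dotG_extd k (a : k.+2.-tuple V -> R) (b : k.+1.-tuple V -> R) :
  forms G a ->
  dotG w a (extd G b) = (k.+1)`!%:R^-1 *
    \sum_(t : k.+1.-tuple V) \sum_u
      a [tuple of u :: t] * b t * wt w [tuple of u :: t].
Proof.
move=> [sa a0]; rewrite /dotG.
have -> : \sum_t a t * extd G b t * wt w t =
  \sum_(j < k.+2) \sum_t a t * ((-1) ^+ j * b (del_tuple j t)) * wt w t.
  rewrite exchange_big; apply: eq_bigr => t _ /=; rewrite /extd.
  have [_|/a0 ->] := ifPn; first by rewrite mulr_sumr mulr_suml.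
  by rewrite !mul0r big1 // => j _; rewrite !mul0r.
rewrite (eq_bigr (fun=> \sum_(t : k.+1.-tuple V) \sum_u
      a [tuple of u :: t] * b t * wt w [tuple of u :: t])) => [|j _]; last first.
  rewrite [RHS]exchange_big.
  transitivity (\sum_t a t * b (del_tuple ord0 t) * wt w t); last first.
    rewrite big_tuple_cons; apply: eq_bigr => u _; apply: eq_bigr => t _.
    by rewrite del_tuple0_cons.
  (* [lift_perm j ord0 1] sends [j] to [0] and keeps the other indices in order, so its sign is
     [(-1)^j]. *)
  rewrite (big_perm_tuple (lift_perm j ord0 1)); apply: eq_bigr => t _.
  rewrite wt_sym del_tuple_lift_perm perm_tuple1 sa odd_lift_perm addbF odd_perm1 addbF.
  by rewrite signr_odd mulrACA -expr2 sqrr_sign mul1r.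
rewrite sumr_const card_ord -[X in _ * X]mulr_natl mulrA; congr (_ * _).
by rewrite factS natrM invfM mulrAC mulVf ?mul1r // pnatr_eq0.
Qed.

Lemma codiffP k (a : k.+2.-tuple V -> R) :
  forms G a -> is_adjoint_value w a (codiff w a).
Proof.
move=> fa; have [sa a0] := fa; apply: xgetPex.
(* The witness is read off from [dotG_extd] as the coefficient of [b t * wt w t]. Off cliques the
   weight is [0], and the convention [x / 0 = 0] yields the support condition. *)
exists (fun t : k.+1.-tuple V =>
  (\sum_u a [tuple of u :: t] * wt w [tuple of u :: t]) / wt w t).
split; first split.
- move=> s t; rewrite wt_sym mulrA mulr_sumr; congr (_ / _).
  by apply: eq_bigr => u _; rewrite skew_cons // wt_cons mulrA.
- by move=> t /(wt_eq0 w) ->; rewrite invr0 mulr0.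
move=> b [sb b0]; rewrite dotG_extd //; congr (_ * _); apply: eq_bigr => t _.
have [/(wt_gt0 w)/lt0r_neq0 wt_neq0|/b0 ->] := boolP ([set x in t] \in cliques G k.+1).
  rewrite mulrAC divfK // mulr_suml; apply: eq_bigr => u _.
  by rewrite mulrAC.
by rewrite mulr0 mul0r big1 // => u _; rewrite mulr0 mul0r.
Qed.

(** Adjointness only speaks of products over all of [G], so the restriction to the interior is first
    moved onto [b]. *)
Lemma dotO_codiff B k (a : k.+2.-tuple V -> R) (b : k.+1.-tuple V -> R) :
  forms G a -> forms G b ->
  dotO w B (codiff w a) b = (k.+1)`!%:R^-1 *
    \sum_(t : k.+1.-tuple V | [set x in t] \subset ~: B) \sum_u
      a [tuple of u :: t] * b t * wt w [tuple of u :: t].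
Proof.
move=> fa fb; have [fc adj_c] := codiffP fa.
rewrite dotO_restrict // adj_c; last exact: forms_restrict.
rewrite dotG_extd //; congr (_ * _).
rewrite [RHS]big_mkcond; apply: eq_bigr => t _; rewrite /restrict_form.
by case: ifP => // _; rewrite big1 // => u _; rewrite mulr0 mul0r.
Qed.

End Forms.

(** * Cliques and their boundary vertices *)

Lemma uniq_clique (V : finType) (G : sgraph V) n (t : n.-tuple V) :
  [set x in t] \in cliques G n -> uniq t.
Proof.
rewrite inE => /andP[/eqP tn _]; apply/card_uniqP.
by rewrite size_tuple -[RHS]tn cardsE.
Qed.

Lemma cliques_behead (V : finType) (G : sgraph V) n u (t : n.-tuple V) :
  [set x in [tuple of u :: t]] \in cliques G n.+1 ->
  [set x in t] \in cliques G n.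
Proof.
move=> utC; have /andP[ut _] := uniq_clique utC.
move: utC; rewrite set_tuple_cons !inE => /andP[].
rewrite cardsU1 inE ut add1n eqSS => -> /forall_inP utadj.
apply/forall_inP => x xt; apply/forall_inP => y yt.
have /forall_inP := utadj x (setU1r _ xt).
by apply; apply: setU1r.
Qed.

Section Boundary.
Variables (R : realType) (V : finType) (G : sgraph V) (B : {set V}).
Hypothesis hB : is_boundary G B.

Lemma clique_boundary_le1 n (S : {set V}) x y :
  S \in cliques G n -> x \in S -> y \in S -> x \in B -> y \in B -> x = y.
Proof.
rewrite inE => /andP[_ /forall_inP S_adj] xS yS xB yB; apply/eqP/negPn/negP => xy.
have /forall_inP/(_ y yS)/implyP/(_ xy) := S_adj x xS.
exact/negP/(hB.1 x y xB yB).
Qed.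

(** In a clique the two boundary vertices would coincide; then [u] would occur twice, leaving too
    few distinct vertices. *)
Lemma clique_cons_boundaryF k u (t : k.-tuple V) :
  u \in B -> has (mem B) t -> [set x in [tuple of u :: t]] \notin cliques G k.+1.
Proof.
move=> uB /hasP[x xt xB]; apply/negP => tC.
have /andP[/negP ut _] := uniq_clique tC; apply: ut.
by rewrite (clique_boundary_le1 tC (x := u) (y := x)) // !inE ?eqxx ?xt ?orbT.
Qed.

Lemma set_bdtupleI k (v : vset B) (s : k.-tuple (vset (~: B))) :
  [set x in bdtuple v s] :&: B = [set val v].
Proof.
apply/setP => x; rewrite !inE; apply/andP/eqP => [[/orP[/eqP //|]]|->]; last first.
  by rewrite eqxx; split => //; apply: valP.
by case/mapP => y _ ->; have := valP y; rewrite inE => /negbTE ->.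
Qed.

Lemma bdtuple_cliques k (v : vset B) (s : k.-tuple (vset (~: B))) n :
  ([set x in bdtuple v s] \in bdcliques G B n) =
  ([set x in bdtuple v s] \in cliques G n).
Proof. by rewrite inE set_bdtupleI cards1 eqxx andbT. Qed.

Lemma map_val_perm_tuple (A : {set V}) k s (t : k.-tuple (vset A)) :
  map_tuple val (perm_tuple s t) = perm_tuple s (map_tuple val t).
Proof.
by apply: eq_from_tnth => i; rewrite tnth_map !tnth_perm_tuple tnth_map.
Qed.

Lemma bdtuple_perm k (v : vset B) s (t : k.-tuple (vset (~: B))) :
  bdtuple v (perm_tuple s t) =
  perm_tuple (lift_perm ord0 ord0 s) (bdtuple v t).
Proof.
by rewrite -(perm_tuple_cons s (val v) (map_tuple val t)) -map_val_perm_tuple.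
Qed.

Lemma sum_bdtuple k (F : k.+1.-tuple V -> R) :
  \sum_(v : vset B) \sum_(s : k.-tuple (vset (~: B))) F (bdtuple v s) =
  \sum_(v in B) \sum_(t : k.-tuple V | [set x in t] \subset ~: B)
    F [tuple of v :: t].
Proof.
rewrite (@big_sub _ _ _ _ (mem B)); apply: eq_bigr => v _.
by rewrite -(big_tuple_sub _ (fun t => F [tuple of val v :: t])).
Qed.

(* A clique has at most one vertex in [B], and by symmetry that vertex may be
   assumed to come first. *)
Lemma sum_tuple_boundary k (F : k.+1.-tuple V -> R) :
  (forall s t, F (perm_tuple s t) = F t) ->
  (forall t, [set x in t] \notin cliques G k.+1 -> F t = 0) ->
  \sum_t F t = \sum_(t : k.+1.-tuple V | [set x in t] \subset ~: B) F t +
    (\sum_(v : vset B) \sum_(s : k.-tuple (vset (~: B))) F (bdtuple v s)) *+ k.+1.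
Proof.
move=> F_sym F0.
(* A clique has either no boundary vertex or exactly one, at a single position [i], so at most one
   of these terms is nonzero. *)
have splitF t : F t = (if [set x in t] \subset ~: B then F t else 0) +
    \sum_(i < k.+1) (if tnth t i \in B then F t else 0).
  have [tC|/F0 ->] := boolP ([set x in t] \in cliques G k.+1); last first.
    by rewrite if_same add0r big1 // => i _; rewrite if_same.
  case: ifPn => [/fintype.subsetP tO|].
    rewrite big1 ?addr0 // => i _; rewrite ifN //.
    by have := tO (tnth t i); rewrite !inE; apply; rewrite mem_tnth.
  case/fintype.subsetPn => x; rewrite !inE negbK => /tnthP[i ->] iB.
  rewrite add0r (bigD1 i) //= iB big1 ?addr0 // => j ji; rewrite ifN //.
  apply: contra ji => jB; apply/eqP.
  by apply/(tuple_uniqP _ (uniq_clique tC))/(clique_boundary_le1 tC); rewrite ?inE ?mem_tnth.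
rewrite (eq_bigr _ (fun t _ => splitF t)) big_split /= -big_mkcond /=; congr (_ + _).
rewrite exchange_big /= -[in RHS](card_ord k.+1) -sumr_const; apply: eq_bigr => i _.
(* Transposing [0] and [i] brings the boundary vertex to the front, so all [k+1] positions give the
   same sum. *)
rewrite (big_perm_tuple (tperm ord0 i)).
transitivity (\sum_(t : k.+1.-tuple V) if thead t \in B then F t else 0).
  by apply: eq_bigr => t _; rewrite F_sym tnth_perm_tuple tpermR.
rewrite big_tuple_cons sum_bdtuple [RHS]big_mkcond; apply: eq_bigr => u _.
case: ifPn => uB; last exact: big1.
rewrite [RHS]big_mkcond; apply: eq_bigr => t _.
case: ifPn => // /fintype.subsetPn[x]; rewrite !inE negbK => xt xB.
by apply/F0/clique_cons_boundaryF => //; apply/hasP; exists x.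
Qed.

End Boundary.

(** * The boundary operators and the two identities *)

Section BoundaryForms.
Variables (R : realType) (V : finType) (G : sgraph V) (w : weight R G).
Variable B : {set V}.

Lemma bdforms_bdN k (a : k.+2.-tuple V -> R) :
  forms G a -> bdforms G (bdN w (B := B) a).
Proof.
move=> [sa _]; split => [v s t|v s /negbTE sC]; last by rewrite /bdN sC.
rewrite /bdN bdtuple_perm set_perm_tuple; case: ifP => _; last by rewrite mulr0.
rewrite wt_sym mulrA mulr_sumr; congr (_ / _); apply: eq_bigr => u _.
by rewrite skew_cons // wt_cons odd_lift_perm mulrA.
Qed.

Lemma bdforms_bdD k (a : k.+1.-tuple V -> R) :
  forms G a -> bdforms G (bdD G (B := B) a).
Proof.
move=> [sa _]; split => [v s t|v s /negbTE sC]; last by rewrite /bdD sC.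
rewrite /bdD bdtuple_perm set_perm_tuple; case: ifP => _; last by rewrite mulr0.
by rewrite -sa -map_val_perm_tuple.
Qed.

Hypothesis hB : is_boundary G B.

(** The denominator of [bdN] cancels the weight of the boundary product. Terms with [u] in [B]
    vanish because [v] is already a boundary vertex, so [u] may range over all vertices. *)
Lemma dotB_bdN k (a : k.+2.-tuple V -> R) (b : k.+1.-tuple V -> R) :
  forms G a ->
  dotB w (bdN w (B := B) a) (bdrestr b) = k`!%:R^-1 *
    \sum_(v : vset B) \sum_(s : k.-tuple (vset (~: B))) \sum_u
      a [tuple of u :: bdtuple v s] * b (bdtuple v s) *
      wt w [tuple of u :: bdtuple v s].
Proof.
move=> [_ a0]; congr (_ * _); apply: eq_bigr => v _; apply: eq_bigr => s _.
rewrite /bdN /bdrestr bdtuple_cliques; have [sC|sC] := ifPn; last first.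
  (* Off cliques [bdN] takes its default value [0]; the other side vanishes too, since the tail of a
     clique tuple is a clique. *)
  rewrite !mul0r big1 // => u _; rewrite a0 ?mul0r //; apply: contra sC.
  exact: cliques_behead.
rewrite mulrAC divfK ?lt0r_neq0 ?wt_gt0 // mulr_suml [LHS]big_mkcond.
apply: eq_bigr => u _; rewrite inE; case: ifPn => [_|]; first by rewrite mulrAC.
rewrite negbK => uB; rewrite a0 ?mul0r //.
by apply: (clique_cons_boundaryF hB) => //=; rewrite (valP v).
Qed.

Lemma dotB_bdD k (a : k.+1.-tuple V -> R) (b : k.+2.-tuple V -> R) :
  dotB w (bdD G (B := B) a) (bdrestr b) = (k.+1)`!%:R^-1 *
    \sum_(v in B) \sum_(t : k.+1.-tuple V | [set x in t] \subset ~: B)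
      b [tuple of v :: t] * a t * wt w [tuple of v :: t].
Proof.
congr (_ * _); pose F t := b t * a (del_tuple ord0 t) * wt w t.
transitivity (\sum_(v : vset B) \sum_(s : k.+1.-tuple (vset (~: B))) F (bdtuple v s)).
  apply: eq_bigr => v _; apply: eq_bigr => s _.
  rewrite /F /bdD /bdrestr bdtuple_cliques del_tuple0_cons.
  have [_|/(wt_eq0 w) ->] := ifPn; last by rewrite !mulr0.
  by rewrite [a _ * _]mulrC.
rewrite sum_bdtuple; apply: eq_bigr => v _; apply: eq_bigr => t _.
by rewrite /F del_tuple0_cons.
Qed.

Lemma dotO_codiffl k (a : k.+2.-tuple V -> R) (b : k.+1.-tuple V -> R) :
  forms G a -> forms G b ->
  dotO w B (codiff w a) b =
    dotG w a (extd G b) - dotB w (bdN w (B := B) a) (bdrestr b).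
Proof.
move=> fa fb; have [[sa _] [sb b0]] := (fa, fb).
rewrite dotO_codiff // dotG_extd // dotB_bdN //.
set F := fun t : k.+1.-tuple V =>
  \sum_u a [tuple of u :: t] * b t * wt w [tuple of u :: t].
have F_sym s t : F (perm_tuple s t) = F t.
  apply: eq_bigr => u _; rewrite wt_cons skew_cons // sb mulrACA -expr2.
  by rewrite sqrr_sign mul1r.
have F0 t : [set x in t] \notin cliques G k.+1 -> F t = 0.
  by move=> /b0 bt; apply: big1 => u _; rewrite bt mulr0 mul0r.
rewrite (sum_tuple_boundary hB F_sym F0) mulrDr.
(* The [k+1] possible positions of the boundary vertex turn [1/(k+1)!] into [1/k!]. *)
set S := \sum_v _; suff -> : (k.+1)`!%:R^-1 * (S *+ k.+1) = k`!%:R^-1 * S.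
  by rewrite addrK.
rewrite -[X in _ * X = _]mulr_natl mulrA; congr (_ * _).
by rewrite factS natrM invfM mulrAC mulVf ?mul1r // pnatr_eq0.
Qed.

Lemma dotO_extdl k (a : k.+1.-tuple V -> R) (b : k.+2.-tuple V -> R) :
  forms G a -> forms G b ->
  dotO w B (extd G a) b =
    dotO w B a (codiff w b) - dotB w (bdD G (B := B) a) (bdrestr b).
Proof.
move=> fa fb; have fbO := forms_restrict (~: B) fb.
rewrite [dotO w B a _]dotOC dotO_codiff // dotB_bdD.
rewrite dotO_restrict //; last exact: forms_extd.
(* After the exchange, the restricted [b] is the form of higher degree in [dotG_extd]. *)
rewrite dotGC dotG_extd // -mulrBr; congr (_ * _).
rewrite [\sum_(v in B) _]exchange_big -sumrB [RHS]big_mkcond.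
apply: eq_bigr => t _; case: ifPn => tO; last first.
  apply: big1 => u _; rewrite /restrict_form set_tuple_cons finset.subUset (negbTE tO).
  by rewrite andbF !mul0r.
(* The part with [u] in [B] cancels the boundary term; the remaining [u] are those kept by the
   restriction of [b]. *)
rewrite [X in _ = X - _](bigID (mem B)) /= addrAC subrr add0r [RHS]big_mkcond.
apply: eq_bigr => u _; rewrite /restrict_form set_tuple_cons finset.subUset tO finset.sub1set.
by rewrite inE andbT; case: ifP; rewrite // !mul0r.
Qed.

End BoundaryForms.

Theorem proposition3p1 (R : realType) (V : finType) (G : sgraph V)
    (B : {set V}) (hB : is_boundary G B) (w : weight R G) :
  (forall (k : nat) (a : k.+2.-tuple V -> R) (b : k.+1.-tuple V -> R),
     forms G a -> forms G b ->
     bdforms G (bdN w (B := B) a) /\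
     dotO w B (codiff w a) b =
       dotG w a (extd G b) - dotB w (bdN w (B := B) a) (bdrestr b)) /\
  (forall (k : nat) (a : k.+1.-tuple V -> R) (b : k.+2.-tuple V -> R),
     forms G a -> forms G b ->
     bdforms G (bdD G (B := B) a) /\
     dotO w B (extd G a) b =
       dotO w B a (codiff w b) - dotB w (bdD G (B := B) a) (bdrestr b)).
Proof.
split => k a b fa fb; split.
- exact: bdforms_bdN.
- exact: dotO_codiffl.
- exact: bdforms_bdD.
- exact: dotO_extdl.
Qed.
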